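(* Let $q$ be a prime power, $k\ge 1$, and let $m,n\ge 0$ be integers. Then $$P_k(m;n)=\sum_{0\le d\le\min\{m,n\}}N_k(m-d)N_k(n-d)A_k(d),$$ where $$A_k(d)=\sum_{h\in\mathcal N_k(d)}\mu(h)=\sum_{\substack{a_1,\dots,a_d\ge 0\\ 1a_1+2a_2+\cdots+da_d=d}}(-1)^{a_1+\cdots+a_d}\binom{I_k(1)}{a_1}\cdots\binom{I_k(d)}{a_d}.$$
   Context: $\mathbb F_q$ is the finite field with $q$ elements. Two polynomials in $\mathbb F_q[x_1,\dots,x_k]$ are identified if they differ by a factor in $\mathbb F_q^\times$; the classes are called normalized polynomials. For an integer $m\ge 0$, $\mathcal N_k(m)$ is the set of normalized (nonzero) polynomials in $\mathbb F_q[x_1,\dots,x_k]$ of total degree $m$, $N_k(m)=|\mathcal N_k(m)|$, and $I_k(m)$ is the number of irreducible elements of $\mathcal N_k(m)$. $P_k(m;n)=|\{(f,g)\in\mathcal N_k(m)\times\mathcal N_k(n):\gcd(f,g)=1\}|$. The Möbius function $\mu$ on nonzero normalized polynomials is $\mu(h)=(-1)^s$ if $h$ is a product of $s$ distinct irreducibles, and $\mu(h)=0$ if $h$ is divisible by the square of an irreducible. *)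

(* Defs.v *)
From HB Require Import structures.
From mathcomp Require Import all_boot all_algebra.
From mathcomp Require Import finmap boolp classical_sets functions cardinality.
From mathcomp Require Import fsbigop.
From mathcomp Require Import mpoly.

Set Implicit Arguments.
Unset Strict Implicit.
Unset Printing Implicit Defensive.

Import GRing.Theory.
Local Open Scope classical_set_scope.
Local Open Scope ring_scope.
Local Open Scope quotient_scope.

Definition dvdr (R : idomainType) (d a : R) : Prop := exists c, a = c * d.

Definition irreducible (R : idomainType) (p : R) : Prop :=
  [/\ p != 0, p \isn't a GRing.unit
    & forall a b, p = a * b -> a \is a GRing.unit \/ b \is a GRing.unit].

Definition is_gcd (R : idomainType) (d a b : R) : Prop :=
  [/\ dvdr d a, dvdr d b & forall e, dvdr e a -> dvdr e b -> dvdr e d].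

Definition nzscale (F : finFieldType) (k : nat) : rel {mpoly F[k]} :=
  fun p q => [exists c : F, (c != 0) && (p == c *: q)].

Lemma nzscaleP (F : finFieldType) (k : nat) (p q : {mpoly F[k]}) :
  reflect (exists2 c : F, c != 0 & p = c *: q) (nzscale p q).
Proof.
apply: (iffP existsP) => [[c /andP[c0 /eqP->]]|[c c0 ->]]; exists c => //.
by rewrite c0 eqxx.
Qed.

Lemma nzscale_refl (F : finFieldType) (k : nat) : reflexive (@nzscale F k).
Proof. by move=> p; apply/nzscaleP; exists 1; rewrite ?oner_eq0 ?scale1r. Qed.

Lemma nzscale_sym (F : finFieldType) (k : nat) : ssrbool.symmetric (@nzscale F k).
Proof.
suff H p q : @nzscale F k p q -> nzscale q p by move=> p q; apply/idP/idP => /H.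
case/nzscaleP => c c0 ->; apply/nzscaleP; exists c^-1; first by rewrite invr_eq0.
by rewrite scalerA mulVf // scale1r.
Qed.

Lemma nzscale_trans (F : finFieldType) (k : nat) : transitive (@nzscale F k).
Proof.
move=> q p r /nzscaleP[c c0 ->] /nzscaleP[c' c'0 ->]; apply/nzscaleP.
by exists (c * c'); rewrite ?mulf_neq0 ?scalerA.
Qed.

Canonical nzscale_equiv (F : finFieldType) (k : nat) :=
  EquivRel (@nzscale F k) (@nzscale_refl F k) (@nzscale_sym F k)
    (@nzscale_trans F k).

(* Also contains the class of 0; it is excluded by the degree condition in
   [normalized] below. *)
Definition normpoly (F : finFieldType) (k : nat) :=
  {eq_quot (@nzscale_equiv F k)}.
HB.instance Definition _ (F : finFieldType) (k : nat) :=
  Choice.on (normpoly F k).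
HB.instance Definition _ (F : finFieldType) (k : nat) :=
  EqQuotient.on (normpoly F k).

(* The notions below are stated on the representative [repr h]; they do not
   depend on the choice of representative. *)

Lemma repr_pi_scale (F : finFieldType) (k : nat) (p : {mpoly F[k]}) :
  exists2 c : F, c != 0 & repr (\pi_(normpoly F k) p) = c *: p.
Proof.
apply/nzscaleP; rewrite -[nzscale _ _]/(nzscale_equiv F k _ _) -eqmodE.
by rewrite reprK.
Qed.

(* [msize p] is the total degree of [p] plus 1, and [msize 0 = 0]. *)
Definition normalized (F : finFieldType) (k m : nat) : set (normpoly F k) :=
  [set h | msize (repr h) = m.+1].

Lemma finite_normalized (F : finFieldType) (k m : nat) :
  finite_set (@normalized F k m).
Proof.
pose g (f : {ffun 'X_{1..k < m.+1} -> F}) :=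
  \pi_(normpoly F k) (\sum_(b : 'X_{1..k < m.+1}) f b *: 'X_[b]).
apply: (@sub_finite_set _ _ (g @` setT)); last exact/finite_image/finite_finset.
move=> h hm; exists [ffun b : 'X_{1..k < m.+1} => (repr h)@_b] => //.
rewrite /g -[RHS]reprK; congr (\pi _).
rewrite [RHS](mpolywE (k := m.+1)) ?hm //.
by apply: eq_bigr => b _; rewrite ffunE.
Qed.

Definition numN (F : finFieldType) (k m : nat) : nat :=
  #|` fset_set (@normalized F k m)|.

Definition numI (F : finFieldType) (k m : nat) : nat :=
  #|` fset_set [set h | @normalized F k m h /\ irreducible (repr h)]|.

Definition numP (F : finFieldType) (k m n : nat) : nat :=
  #|` fset_set [set fg : normpoly F k * normpoly F k |
        [/\ normalized m fg.1, normalized n fg.2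
          & is_gcd 1 (repr fg.1) (repr fg.2)]]|.

Definition distinct_factors (F : finFieldType) (k : nat) (h : normpoly F k)
    (s : seq (normpoly F k)) : Prop :=
  [/\ uniq s, {in s, forall p, irreducible (repr p)}
    & h = \pi_(normpoly F k) (\prod_(p <- s) repr p)].

(* A nonzero [h] not divisible by the square of an irreducible is a product of
   distinct irreducibles, so [xget] returns such a factorization; the number of
   factors does not depend on the one chosen. *)
Definition mobius (F : finFieldType) (k : nat) (h : normpoly F k) : int :=
  if `[< exists2 p, irreducible p & dvdr (p ^+ 2) (repr h) >] then 0
  else (-1) ^+ size (xget [::] [set s | distinct_factors h s]).

Definition sumA (F : finFieldType) (k d : nat) : int :=
  \sum_(h \in @normalized F k d) mobius h.

(* Main.v *)
Require Import Defs.
From mathcomp Require Import finmap boolp classical_sets functions cardinality.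
From mathcomp Require Import fsbigop mpoly.
From mathcomp Require Import all_boot all_algebra.

(* The classes h with mu(h) <> 0 correspond to finite sets of irreducible
   classes, mu(h) being (-1) to the size of the set and the degree of h the sum
   of the degrees; so A_k(d) is a signed count of sets of irreducibles, and
   sorting these sets by the number a_i of members of degree i gives the
   binomial formula.  Two nonzero polynomials f and g are coprime iff the set S
   of their common irreducible divisors is empty, i.e. iff the sum of (-1)^|P|
   over the subsets P of S is 1 rather than 0.  As P is contained in S iff the
   product h of P divides f and g, and h has N_k(m - deg h) multiples of degree
   m, exchanging the summations gives the formula for P_k(m;n).

   Unique factorization in F[x_1, ..., x_k] is Gauss's lemma iterated along
   F[x_1, ..., x_(k+1)] = F[x_1, ..., x_k][x_(k+1)].  In the criterion "every
   nonzero element is a unit times a product of primes", the products of primes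
   are closed under taking divisors, so over a factorial R it is enough that
   each f in R[x] divides such a product up to a constant: either f is reducible
   over the fraction field and one inducts on the degree, or its primitive part
   is prime. *)

Set Implicit Arguments.
Unset Strict Implicit.
Unset Printing Implicit Defensive.

Import GRing.Theory.
Local Open Scope ring_scope.

(** * Unique factorization *)

Section Divisibility.
Variable R : idomainType.
Implicit Types a b c p q u : R.

Lemma dvdr_refl a : dvdr a a. Proof. by exists 1; rewrite mul1r. Qed.

Lemma dvdr_trans a b c : dvdr a b -> dvdr b c -> dvdr a c.
Proof. by case=> x -> [y ->]; exists (y * x); rewrite mulrA. Qed.

Lemma dvdr_mull a b c : dvdr a b -> dvdr a (c * b).
Proof. by case=> x ->; exists (c * x); rewrite mulrA. Qed.

Lemma dvdr_mulr a b c : dvdr a b -> dvdr a (b * c).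
Proof. by rewrite mulrC; apply: dvdr_mull. Qed.

Lemma dvdrD a b c : dvdr a b -> dvdr a c -> dvdr a (b + c).
Proof. by case=> x -> [y ->]; exists (x + y); rewrite mulrDl. Qed.

Lemma dvdr_unit a u : u \is a GRing.unit -> dvdr a u -> a \is a GRing.unit.
Proof. by move=> uU [c uE]; move: uU; rewrite uE unitrM => /andP[]. Qed.

Lemma unit_dvdr a u : u \is a GRing.unit -> dvdr u a.
Proof. by move=> uU; exists (a / u); rewrite divrK. Qed.

Lemma dvdr_neq0 a b : b != 0 -> dvdr a b -> a != 0.
Proof. by move=> b0 [c bE]; move: b0; rewrite bE mulf_eq0 negb_or => /andP[]. Qed.

Definition prime_elt p : Prop :=
  [/\ p != 0, p \isn't a GRing.unit
    & forall a b, dvdr p (a * b) -> dvdr p a \/ dvdr p b].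

Definition prime_product a : Prop := exists u s,
  [/\ u \is a GRing.unit, {in s, forall p, prime_elt p} & a = u * \prod_(p <- s) p].

Lemma prime_dvdr_prod (I : eqType) (s : seq I) (F : I -> R) p :
  prime_elt p -> dvdr p (\prod_(i <- s) F i) -> exists2 i, i \in s & dvdr p (F i).
Proof.
case=> p0 pU pP; elim: s => [|i s IH].
  by rewrite big_nil => /(dvdr_unit (unitr1 _)); rewrite (negPf pU).
rewrite big_cons => /pP[ip|/IH[j js pj]]; first by exists i; rewrite ?mem_head.
by exists j; rewrite // in_cons js orbT.
Qed.

Lemma prime_eltW p : prime_elt p -> irreducible p.
Proof.
case=> p0 pU pP; split=> // a b pE.
have [|[c aE]|[c bE]] := pP a b; first by rewrite -pE; exact: dvdr_refl.
- right; apply/unitrPr; exists c; apply: (mulIf p0).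
  by rewrite mul1r -mulrA -aE mulrC -pE.
left; apply/unitrPr; exists c; apply: (mulIf p0).
by rewrite mul1r -mulrA -bE -pE.
Qed.

Lemma irreducible_dvdr p q : irreducible p -> irreducible q -> dvdr p q ->
  exists2 u, u \is a GRing.unit & q = u * p.
Proof.
by move=> [_ pU _] [_ _ qP] [c qE]; exists c => //; case: (qP _ _ qE); rewrite ?(negPf pU).
Qed.

(** A prime divisor [p] of the product is associated to one of the listed primes; that prime is
    removed and the unit relating the two goes into [u']. The drop in [size] drives the induction in
    [irreducible_poly_prime_product]. *)
Lemma prime_product_split p u s : prime_elt p -> u \is a GRing.unit ->
  {in s, forall q, prime_elt q} -> dvdr p (u * \prod_(q <- s) q) ->
  exists u' s', [/\ u' \is a GRing.unit, {in s', forall q, prime_elt q},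
    size s = (size s').+1 & u * \prod_(q <- s) q = p * (u' * \prod_(q <- s') q)].
Proof.
move=> pp uU sP; have [_ pU pP] := pp.
move=> /pP[/(dvdr_unit uU)|]; first by rewrite (negPf pU).
move=> /(prime_dvdr_prod pp)[q qs pq].
have [c cU qE] := irreducible_dvdr (prime_eltW pp) (prime_eltW (sP _ qs)) pq.
exists (u * c), (rem q s); split; rewrite ?unitrM ?uU //.
- by move=> r /mem_rem /sP.
- by rewrite size_rem // prednK //; case: (s) qs.
by rewrite (big_rem q) //= {1}qE !mulrA; congr (_ * _); rewrite mulrC mulrA.
Qed.

Lemma prime_product_mul a b : prime_product a -> prime_product b -> prime_product (a * b).
Proof.
move=> [u [s [uU sP ->]]] [v [t [vU tP ->]]]; exists (u * v), (s ++ t).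
split; first by rewrite unitrM uU.
  by move=> p; rewrite mem_cat => /orP[/sP|/tP].
by rewrite big_cat /= mulrACA.
Qed.

Lemma prime_product_unit u : u \is a GRing.unit -> prime_product u.
Proof. by move=> uU; exists u, [::]; rewrite big_nil mulr1. Qed.

Lemma prime_product_prime p : prime_elt p -> prime_product p.
Proof.
move=> pp; exists 1, [:: p]; rewrite unitr1 big_seq1 mul1r; split=> // q.
by rewrite inE => /eqP->.
Qed.

(** Induction on the number of primes in [b]: the first one divides the cofactor [c] or divides [a],
    and is cancelled from that side. *)
Lemma prime_product_dvdr a b : dvdr a b -> prime_product b -> prime_product a.
Proof.
move=> [c bE] [u [s [uU sP bE']]]; rewrite {b}bE in bE'.
elim: s u a c uU sP bE' => [|p s IH] u a c uU sP E.
  apply: prime_product_unit; apply: (dvdr_unit uU); exists c.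
  by rewrite E big_nil mulr1.
have pp : prime_elt p by apply: sP; rewrite mem_head.
have [p0 _ pP] := pp.
have sP' : {in s, forall q, prime_elt q} by move=> q qs; apply: sP; rewrite in_cons qs orbT.
have : dvdr p (c * a).
  by rewrite E big_cons; exists (u * \prod_(q <- s) q); rewrite mulrCA mulrC.
move=> /pP[[d cE]|[d aE]].
  apply: (IH u a d) => //; apply: (mulIf p0).
  by rewrite mulrAC -cE E big_cons -mulrA (mulrC p).
rewrite aE; apply: prime_product_mul; last exact: prime_product_prime.
apply: (IH u d c) => //; apply: (mulIf p0).
by rewrite -mulrA -aE E big_cons -mulrA (mulrC p).
Qed.

End Divisibility.

Definition is_ufd (R : idomainType) : Prop := forall a : R, a != 0 -> prime_product a.

(** The first prime [q] in a factorization of [p] is not a unit, so irreducibility makes the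
    remaining factor [v] a unit, and [p] is associated to [q]. *)
Lemma ufd_prime (R : idomainType) (p : R) : is_ufd R -> irreducible p -> prime_elt p.
Proof.
move=> ufd [p0 pU pP]; have [u [[|q s] [uU sP pE]]] := ufd _ p0.
  by move: pU; rewrite pE big_nil mulr1 uU.
have [q0 qU qP] : prime_elt q by apply: sP; rewrite mem_head.
move: pE; rewrite big_cons mulrCA => pE.
have [|vU] := pP _ _ pE; first by rewrite (negPf qU).
set v := (u * _) in pE vU.
split=> // a b [c abE].
have [|[d aE]|[d bE]] := qP a b; first by rewrite abE pE; apply/dvdr_mull/dvdr_mulr/dvdr_refl.
- by left; exists (d / v); rewrite aE pE mulrA mulrAC divrK.
- by right; exists (d / v); rewrite bE pE mulrA mulrAC divrK.
Qed.

Lemma bij_ufd (R S : idomainType) (f : {rmorphism R -> S}) (g : S -> R) :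
  cancel f g -> cancel g f -> is_ufd R -> is_ufd S.
Proof.
move=> fK gK ufd.
have fU x : (f x \is a GRing.unit) = (x \is a GRing.unit).
  apply/idP/idP; last exact: rmorph_unit.
  case/unitrP => y [yx _]; apply/unitrPr; exists (g y); apply: (can_inj fK).
  by rewrite rmorphM gK rmorph1 mulrC.
have fdvd x y : dvdr x (g y) -> dvdr (f x) y.
  by case=> c E; exists (f c); rewrite -rmorphM -E gK.
have gM x y : g (x * y) = g x * g y by apply: (can_inj fK); rewrite rmorphM !gK.
move=> a a0; have [|u [s [uU sP aE]]] := ufd (g a).
  by apply: contra_neq a0 => E; rewrite -(gK a) E rmorph0.
exists (f u), (map f s); split; first by rewrite fU.
  move=> _ /mapP[p /sP[p0 pU pP] ->]; split; rewrite ?fU ?rmorph_eq0 //.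
    by apply: contra_neq p0 => E; rewrite -(fK p) E -(rmorph0 f) fK.
  move=> x y [c E].
  have [|/fdvd|/fdvd] := pP (g x) (g y); [|by left|by right].
  by exists (g c); rewrite -gM E gM fK.
by rewrite -(gK a) aE rmorphM rmorph_prod big_map.
Qed.

(** * Gauss's lemma: polynomials over a factorial domain *)

Section Gauss.
Variable R : idomainType.
Implicit Types (f g h r : {poly R}) (p c : R).

Lemma dvdr_polyCP p f : dvdr p%:P f <-> forall i, dvdr p f`_i.
Proof.
split=> [[c ->] i|H]; first by rewrite coefMC; apply/dvdr_mull/dvdr_refl.
have /choice[q qE] i : exists c, f`_i = c * p by apply: H.
exists (\poly_(i < size f) q i); apply/polyP => i; rewrite coefMC coef_poly.
by case: ltnP => // ?; rewrite mul0r nth_default.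
Qed.

Lemma unit_polyC c : (c%:P \is a GRing.unit) = (c \is a GRing.unit).
Proof.
rewrite poly_unitE coefC eqxx size_polyC.
by have [->|c0] := eqVneq c 0; rewrite ?unitr0.
Qed.

Lemma size_sub_lead f : f != 0 -> (size (f - lead_coef f *: 'X^((size f).-1))%R < size f)%N.
Proof.
move=> f0; rewrite -[ltnRHS]prednK ?size_poly_gt0 // ltnS; apply/leq_sizeP => j.
rewrite coefB coefZ coefXn leq_eqVlt => /orP[/eqP <-|lt].
  by rewrite eqxx mulr1 lead_coefE subrr.
rewrite gtn_eqF // mulr0 subr0 nth_default //.
by rewrite -[leqLHS]prednK ?size_poly_gt0.
Qed.

(** Induction on the sum of the sizes: [p] divides one of the two leading coefficients, and removing
    that leading term keeps the product divisible by [p]. *)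
Lemma prime_polyC p : prime_elt p -> prime_elt p%:P.
Proof.
case=> p0 pU pP; split; rewrite ?polyC_eq0 ?unit_polyC //.
move=> f g; have [n] := ubnP (size f + size g); elim: n f g => // n IH f g.
rewrite ltnS => le_n pfg.
have [->|f0] := eqVneq f 0; first by left; exists 0; rewrite mul0r.
have [->|g0] := eqVneq g 0; first by right; exists 0; rewrite mul0r.
have [pf|pg] : dvdr p (lead_coef f) \/ dvdr p (lead_coef g).
- by apply: pP; rewrite -lead_coefM; apply: (dvdr_polyCP _ _).1.
- have {}pf : dvdr p%:P (lead_coef f *: 'X^((size f).-1)).
    by case: pf => c ->; exists (c *: 'X^((size f).-1)); rewrite [RHS]mulrC mul_polyC scalerA mulrC.
  have [||pf'|] := IH (f - lead_coef f *: 'X^((size f).-1)) g; last by right.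
  + by apply: leq_trans le_n; rewrite ltn_add2r size_sub_lead.
  + by rewrite mulrBl -mulNr; apply: dvdrD => //;
      apply/dvdr_mulr; rewrite -mulN1r; apply: dvdr_mull.
  + by left; rewrite -[f](subrK (lead_coef f *: 'X^((size f).-1))); apply: dvdrD.
have {}pg : dvdr p%:P (lead_coef g *: 'X^((size g).-1)).
  by case: pg => c ->; exists (c *: 'X^((size g).-1)); rewrite [RHS]mulrC mul_polyC scalerA mulrC.
have [|||pg'] := IH f (g - lead_coef g *: 'X^((size g).-1)); [| |by left|].
- by apply: leq_trans le_n; rewrite ltn_add2l size_sub_lead.
- by rewrite mulrBr -mulrN; apply: dvdrD => //; apply/dvdr_mull; rewrite -mulN1r; apply: dvdr_mull.
- by right; rewrite -[g](subrK (lead_coef g *: 'X^((size g).-1))); apply: dvdrD.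
Qed.

Hypothesis ufdR : is_ufd R.

Lemma prime_product_polyC c : c != 0 -> prime_product c%:P.
Proof.
move=> /ufdR[u [s [uU sP ->]]]; exists u%:P, (map polyC s); split.
- by rewrite unit_polyC.
- by move=> _ /mapP[p /sP/prime_polyC pp ->].
by rewrite polyCM rmorph_prod big_map.
Qed.

(* A primitive polynomial that is irreducible over the fraction field is prime;
   [%|] over a domain is divisibility over its fraction field. *)
Lemma primitive_prime f : irreducible_poly f ->
  (forall p, prime_elt p -> ~ dvdr p%:P f) -> prime_elt f.
Proof.
move=> irr prim; have f0 := irredp_neq0 irr; have sf : (1 < size f)%N by case: irr.
have lift g : f %| g -> dvdr f g.
  (* Clearing denominators gives [c *: g = r * f]. Each prime factor of [c] divides [r * f] but not
     [f], so it divides [r] and cancels, until only a unit is left. *)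
  move=> /Pdiv.WeakIdomain.dvdpP[[c r] /= /ufdR[u [s [uU sP ->]]]].
  elim: s r sP => [|p s IH] r sP.
    rewrite big_nil mulr1 => E; exists (u^-1 *: r).
    by rewrite -scalerAl -E scalerA mulVr // scale1r.
  have pp : prime_elt p by apply: sP; rewrite mem_head.
  have [p0 _ _] := pp; have [_ _ pP] := prime_polyC pp.
  rewrite big_cons mulrCA -scalerA => E.
  have [||] := pP r f; [|move=> [r' rE]|by move/(prim p pp)].
    by rewrite -E -mul_polyC; apply/dvdr_mulr/dvdr_refl.
  apply: (IH r') => [q qs|]; first by apply: sP; rewrite in_cons qs orbT.
  apply: (@mulfI _ p%:P); first by rewrite polyC_eq0.
  by rewrite mul_polyC E rE mulrAC mulrC.
split=> //; first by rewrite poly_unitE gtn_eqF.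
move=> g h [r ghE].
have fgh : f %| g * h by rewrite ghE dvdp_mull.
(* Over the fraction field, either the gcd of [f] and [g] is constant and [f] divides [h], or it is
   associated to [f] and [f] divides [g]; [lift] brings this back to [R]. *)
have [/eqP sz|sz] := boolP (size (gcdp f g) == 1)%N.
  by right; apply: lift; rewrite -(Gauss_dvdpr h (q := g)) // coprimep_def sz.
left; apply: lift; have := irr.2 _ sz (dvdp_gcdl _ _).
by move=> /eqp_dvdl <-; apply: dvdp_gcdr.
Qed.

(** Induction on the number of primes in the leading coefficient. If a prime constant divides [f],
    the quotient is still irreducible over the fraction field and its leading coefficient has one
    prime fewer; otherwise [primitive_prime] applies. *)
Lemma irreducible_poly_prime_product f : irreducible_poly f -> prime_product f.
Proof.
move=> irr; have [|u [s [uU sP]]] := ufdR (a := lead_coef f).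
  by rewrite lead_coef_eq0 irredp_neq0.
have [n] := ubnP (size s); elim: n f u s irr uU sP => // n IH f u s irr uU sP.
rewrite ltnS => sz E.
have [[p [pp pf]]|prim] := EM (exists p, prime_elt p /\ dvdr p%:P f); last first.
  by apply/prime_product_prime/primitive_prime => // p pp pf; apply: prim; exists p.
have [g fE] := pf; have [p0 _ _] := pp.
have [|u' [s' [uU' sP' sz' E']]] := prime_product_split pp uU sP.
  by rewrite -E; case: pf => h ->; rewrite lead_coefM lead_coefC; apply/dvdr_mull/dvdr_refl.
rewrite fE; apply: prime_product_mul; last exact/prime_product_polyC.
apply: (IH g u' s') => //; last 2 first.
- by rewrite -ltnS -sz'.
- by apply: (mulfI p0); rewrite -E' -E fE lead_coefM lead_coefC mulrC.
have eq_fg : f %= g by rewrite fE mulrC mul_polyC eqp_scale.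
split=> [|q sq]; first by rewrite -(eqp_size eq_fg); case: irr.
by rewrite -(eqp_dvdr _ eq_fg) -(eqp_rtrans eq_fg); apply: irr.2.
Qed.

(** A proper divisor over the fraction field gives only [c *: f = r * q] with smaller [r] and [q].
    This suffices: [f] divides [r * q], and divisors of products of primes are again such
    products. *)
Lemma poly_ufd : is_ufd {poly R}.
Proof.
move=> f; have [n] := ubnP (size f); elim: n f => // n IH f; rewrite ltnS => le_n f0.
have [sf|sf] := leqP (size f) 1.
  by rewrite (size1_polyC sf); apply: prime_product_polyC; rewrite -polyC_eq0 -size1_polyC.
have [[q [sq qf qdf]]|irr] :=
    EM (exists q : {poly R}, [/\ (1 < size q)%N, (size q < size f)%N & q %| f]); last first.
  apply: irreducible_poly_prime_product; split=> // q sq qf.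
  rewrite -(dvdp_size_eqp qf) eqn_leq dvdp_leq //= leqNgt; apply/negP => lt.
  apply: irr; exists q; split=> //; rewrite ltn_neqAle eq_sym sq size_poly_gt0.
  by apply: contraTneq qf => ->; rewrite dvd0p.
have /Pdiv.WeakIdomain.dvdpP[[c r] /= c0 E] := qdf.
have : r * q != 0 by rewrite -E scale_poly_eq0 negb_or c0.
rewrite mulf_eq0 negb_or => /andP[r0 q0].
have sz : (size f = (size r + size q).-1)%N by rewrite -(size_scale f c0) E size_mul.
apply: (@prime_product_dvdr _ f (r * q)); first by exists c%:P; rewrite mul_polyC.
apply: prime_product_mul; apply: IH => //; last exact: leq_trans le_n.
apply: leq_trans le_n; rewrite sz; case: (size q) sq => [|[|m]] // _.
by rewrite !addnS /= ltnS leq_addr.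
Qed.

End Gauss.

(** * From one variable to several *)

Lemma mpoly_rmorph_ext (A S : nzRingType) (n : nat)
    (h1 h2 : {rmorphism {mpoly A[n]} -> S}) :
  (forall c, h1 c%:MP = h2 c%:MP) -> (forall i, h1 'X_i = h2 'X_i) -> h1 =1 h2.
Proof.
move=> hC hX p; rewrite (mpolyE p) !raddf_sum /=; apply: eq_bigr => m _.
rewrite -mul_mpolyC !rmorphM hC mpolyXE_id !rmorph_prod /=; congr (_ * _).
by apply: eq_bigr => i _; rewrite !rmorphXn hX.
Qed.

Section MpolyUfd.
Variable (A : idomainType).

Lemma muniX_widen n (i : 'I_n) : muni ('X_(widen_ord (leqnSn n) i) : {mpoly A[n.+1]}) = ('X_i)%:P.
Proof.
rewrite muniE msuppX big_seq1 mcoeffX eqxx scale1r mnmE /=.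
rewrite [_ == _]ltn_eqF /= ?ltn_ord // expr0.
have -> : [multinom U_( widen_ord (leqnSn n) i)%MM (widen_ord (leqnSn n) i0)  | i0 < n] = U_(i)%MM.
  by apply/mnmP => j; rewrite !mnmE.
by rewrite alg_polyC.
Qed.

Lemma muniX_max n : muni ('X_ord_max : {mpoly A[n.+1]}) = 'X.
Proof.
rewrite muniE msuppX big_seq1 mcoeffX eqxx scale1r mnmE eqxx expr1.
have -> : [multinom U_( ord_max)%MM (widen_ord (leqnSn n) i0)  | i0 < n] = 0%MM.
  by apply/mnmP => j; rewrite mnmE mnm1E mnmE [_ == _]gtn_eqF /= ?ltn_ord.
by rewrite mpolyX0 scale1r.
Qed.

Lemma muni_mwiden n (c : {mpoly A[n]}) : muni (mwiden c) = c%:P.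
Proof.
have := @mpoly_rmorph_ext _ _ _ (@muni n A \o @mwiden n A) (@polyC {mpoly A[n]}).
apply=> [a|i] /=.
  by rewrite mwidenC muniC.
by rewrite mwidenX mnmwiden1 muniX_widen.
Qed.

(** [muni] singles out the last variable; its inverse [g] widens the coefficients and evaluates at
    that variable. One composite is checked on powers of ['X], the other on constants and
    variables. *)
Lemma mpoly_ufdS n : is_ufd {mpoly A[n]} -> is_ufd {mpoly A[n.+1]}.
Proof.
pose g := horner_eval ('X_ord_max : {mpoly A[n.+1]}) \o map_poly (@mwiden n A).
move=> /poly_ufd; apply: (@bij_ufd _ _ g (@muni n A)) => [p|].
  rewrite /g /= /horner_eval -[p in LHS]coefK poly_def !raddf_sum /=.
  rewrite horner_sum !raddf_sum -[RHS]coefK poly_def; apply: eq_bigr => i _.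
  rewrite /= map_polyZ map_polyXn hornerZ hornerXn muniM muni_mwiden.
  by rewrite rmorphXn /= muniX_max mul_polyC.
have := @mpoly_rmorph_ext _ _ _ (g \o @muni n A) idfun.
apply=> [a|i] /=.
  by rewrite /g /= muniC /horner_eval map_polyC hornerC /= mwidenC.
case: (unliftP ord_max i) => [j|] ->.
  have -> : lift ord_max j = widen_ord (leqnSn n) j.
    by apply/val_inj; rewrite /= /bump leqNgt ltn_ord.
  by rewrite muniX_widen /g /= map_polyC /horner_eval hornerC /= mwidenX mnmwiden1.
by rewrite muniX_max /g /= map_polyX /horner_eval hornerX.
Qed.

End MpolyUfd.

Lemma mpoly_ufd (F : fieldType) n : is_ufd {mpoly F[n]}.
Proof.
elim: n => [p p0|n]; last exact: mpoly_ufdS.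
apply: prime_product_unit.
(* Without variables there is only one monomial, so [p] is a nonzero constant. *)
have E : p = (p@_0)%:MP.
  by apply/mpolyP => m; rewrite mcoeffC (_ : m = 0%MM) ?eqxx ?mulr1 //; apply/mnmP => -[].
rewrite E; apply: rmorph_unit; rewrite unitfE -(mpolyC_eq0 0) -E //.
Qed.

(** * Irreducible classes and the Moebius function *)

Section NormalizedPolynomials.
Variables (F : finFieldType) (k : nat).
Local Notation poly := {mpoly F[k]}.
Local Notation class := (normpoly F k).
Implicit Types (a b p q : poly) (c : F) (f g h : class) (s : seq class).

Lemma mpoly_unitP p : reflect (exists2 c, c != 0 & p = c%:MP) (p \is a GRing.unit).
Proof.
apply: (iffP idP) => [/andP[/eqP pE pU]|[c c0 ->]].
  by exists p@_0; rewrite -?unitfE.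
by apply: rmorph_unit; rewrite unitfE.
Qed.

Lemma dvdrZl c p q : c != 0 -> dvdr p q -> dvdr (c *: p) q.
Proof.
move=> c0 [r ->]; exists (c^-1 *: r).
by rewrite -scalerAl -scalerAr scalerA mulVf // scale1r.
Qed.

Lemma dvdrZr c p q : dvdr p q -> dvdr p (c *: q).
Proof. by move=> pq; rewrite -mul_mpolyC; apply: dvdr_mull. Qed.

Lemma irreducibleZ c p : c != 0 -> irreducible p -> irreducible (c *: p).
Proof.
move=> c0 [p0 pU pP]; have cU : c%:MP \is a @GRing.unit poly by apply/mpoly_unitP; exists c.
rewrite -mul_mpolyC; split; rewrite ?mulf_neq0 ?unitrM ?cU ?mpolyC_eq0 //.
move=> a b E; have [||] := pP (c^-1 *: a) b.
- by rewrite -scalerAl -E mul_mpolyC scalerA mulVf // scale1r.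
- by rewrite -mul_mpolyC unitrM => /andP[_ ->]; left.
- by right.
Qed.

Lemma pi_eqP p q :
  \pi_(normpoly F k)%qT p = \pi_(normpoly F k)%qT q <-> exists2 c, c != 0 & p = c *: q.
Proof.
split=> [/eqP|[c c0 pE]]; first by rewrite eqmodE => /nzscaleP.
by apply/eqP; rewrite eqmodE; apply/nzscaleP; exists c.
Qed.

Lemma repr_pi p : exists2 c, c != 0 & repr (\pi_(normpoly F k)%qT p) = c *: p.
Proof. exact: repr_pi_scale. Qed.

Definition irr f := irreducible (repr f).

Lemma irr_neq0 f : irr f -> repr f != 0. Proof. by case. Qed.

Lemma irr_prime f : irr f -> prime_elt (repr f).
Proof. exact/ufd_prime/mpoly_ufd. Qed.

Lemma irr_pi p : irreducible p -> irr (\pi_(normpoly F k)%qT p).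
Proof. by move=> ip; rewrite /irr; have [c c0 ->] := repr_pi p; apply: irreducibleZ. Qed.

Lemma irr_dvdr_eq f g : irr f -> irr g -> dvdr (repr f) (repr g) -> f = g.
Proof.
move=> fi gi /(irreducible_dvdr fi gi)[u /mpoly_unitP[c c0 ->] E].
rewrite -[f]reprK -[g]reprK; apply/esym/pi_eqP; exists c => //.
by rewrite E mul_mpolyC.
Qed.

Definition rprod s : poly := \prod_(f <- s) repr f.

Lemma rprod_neq0 s : {in s, forall f, irr f} -> rprod s != 0.
Proof. by move=> si; rewrite prodf_seq_neq0; apply/allP => f /si/irr_neq0. Qed.

Lemma irr_dvdr_rprod s f : {in s, forall f, irr f} -> irr f ->
  dvdr (repr f) (rprod s) -> f \in s.
Proof.
move=> si fi /(prime_dvdr_prod (irr_prime fi))[g gs fg].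
by rewrite (irr_dvdr_eq fi (si _ gs) fg).
Qed.

Lemma mem_dvdr_rprod s f : f \in s -> dvdr (repr f) (rprod s).
Proof. by move=> fs; rewrite /rprod (big_rem f) //=; apply/dvdr_mulr/dvdr_refl. Qed.

(** Distinct irreducible classes are pairwise non-associated. If [a = b * rprod s] and a new [f]
    divides [a], the prime [repr f] cannot divide [rprod s], so it divides [b]. *)
Lemma rprod_dvdrP s a : uniq s -> {in s, forall f, irr f} ->
  dvdr (rprod s) a <-> {in s, forall f, dvdr (repr f) a}.
Proof.
move=> us si; split=> [sa f fs|].
  exact: dvdr_trans (mem_dvdr_rprod fs) sa.
elim: s us si => [|f s IH] /=; first by rewrite /rprod big_nil => _ _ _; exists a; rewrite mulr1.
move=> /andP[fs us] si sa.
have si' : {in s, forall f, irr f} by move=> g gs; apply: si; rewrite in_cons gs orbT.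
have fi : irr f by apply: si; rewrite mem_head.
have [|b aE] := IH us si'; first by move=> g gs; apply: sa; rewrite in_cons gs orbT.
have [_ _ fP] := irr_prime fi.
have [|[d bE]|] := fP b (rprod s); first by rewrite -aE; apply: sa; rewrite mem_head.
  by exists d; rewrite aE bE /rprod big_cons mulrA.
by move/(irr_dvdr_rprod si' fi); rewrite (negPf fs).
Qed.

(** The class [f] of [p] must occur in [s]; cancelling one factor, it still divides the product over
    [rem f s], hence would occur a second time. *)
Lemma rprod_squarefree s p : uniq s -> {in s, forall f, irr f} ->
  irreducible p -> ~ dvdr (p ^+ 2) (rprod s).
Proof.
move=> us si ip; have [c c0 E] := repr_pi p; have fi := irr_pi ip.
set f := (\pi p)%qT in E fi.
have [p0 _ _] := ip => sq.
have fs : f \in s.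
  apply: (irr_dvdr_rprod si fi); rewrite E; apply: dvdrZl => //.
  by apply: dvdr_trans sq; rewrite expr2; apply/dvdr_mull/dvdr_refl.
have : dvdr (repr f) (rprod (rem f s)).
  rewrite E; apply: dvdrZl => //; case: sq => d.
  rewrite /rprod (big_rem f) //= E -scalerAl expr2 mulrA => /(canRL (scalerK c0)).
  rewrite [p * _]mulrC scalerAl => /(mulIf p0) ->.
  by rewrite scalerAl; apply/dvdr_mull/dvdr_refl.
move/(irr_dvdr_rprod _ fi); rewrite mem_rem_uniqF // => H.
by case: (notF (H _)) => g /mem_rem /si.
Qed.

Lemma irr_factorization a : a != 0 ->
  exists c s, [/\ c != 0, {in s, forall f, irr f} & a = c *: rprod s].
Proof.
move=> /(@mpoly_ufd F k)[u [s [/mpoly_unitP[c c0 ->] sP ->]]].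
elim: s sP => [|p s IH] sP.
  by exists c, [::]; rewrite /rprod !big_nil mulr1 -mul_mpolyC mulr1; split.
have [|d [t [d0 ti E]]] := IH; first by move=> q qs; apply: sP; rewrite in_cons qs orbT.
have pi : irreducible p by apply/prime_eltW/sP; rewrite mem_head.
have [e e0 pE] := repr_pi p.
(* The representative of the class of [p] is [e *: p]; the scalar [e^-1] compensates for it. *)
exists (d / e), (\pi p :: t)%qT; split; first by rewrite mulf_neq0 ?invr_eq0.
  by move=> f; rewrite in_cons => /orP[/eqP->|/ti //]; apply: irr_pi.
rewrite big_cons mulrCA E /rprod big_cons pE -!scalerAl -scalerAr scalerA.
by rewrite divfK.
Qed.

Lemma rprod_eq_pi s t : uniq s -> uniq t ->
  {in s, forall f, irr f} -> {in t, forall f, irr f} ->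
  \pi_(normpoly F k)%qT (rprod s) = \pi_(normpoly F k)%qT (rprod t) -> s =i t.
Proof.
move=> us ut si ti /pi_eqP[c c0 E] f; apply/idP/idP => fst.
  apply: (irr_dvdr_rprod ti (si _ fst)).
  have := dvdrZr c^-1 (mem_dvdr_rprod fst).
  by rewrite E scalerA mulVf // scale1r.
apply: (irr_dvdr_rprod si (ti _ fst)); rewrite E.
exact/dvdrZr/mem_dvdr_rprod.
Qed.

Lemma mobius_rprod s : uniq s -> {in s, forall f, irr f} ->
  mobius (\pi_(normpoly F k)%qT (rprod s)) = (-1) ^+ size s.
Proof.
move=> us si; rewrite /mobius; case: asboolP => [[p ip]|_].
  have [c c0 ->] := repr_pi (rprod s) => /(dvdrZr c^-1).
  by rewrite scalerA mulVf // scale1r => /(rprod_squarefree us si ip).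
(* The list chosen by [xget] may differ from [s], but both have the same members without repetition,
   hence the same length. *)
congr (_ ^+ _); case: xgetP => [t _|/(_ s)[]]; last by [].
case=> ut ti E; apply: perm_size; apply: uniq_perm => //.
exact/rprod_eq_pi.
Qed.

Lemma mobius_factors h : repr h != 0 -> mobius h != 0 ->
  exists s, distinct_factors h s.
Proof.
rewrite /mobius => h0; case: asboolP; rewrite ?eqxx // => nsq _.
have [c [s [c0 si hE]]] := irr_factorization h0.
exists s; split=> //; last by rewrite -[h]reprK; apply/pi_eqP; exists c.
(* It remains to see that [s] has no repetition. Only divisibility of [repr h] by [rprod s] is kept,
   since it passes to tails; a repeated [f] would give a square dividing [repr h]. *)
have {c0 hE} : dvdr (rprod s) (repr h) by rewrite hE; exact/dvdrZr/dvdr_refl.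
elim: s si => //= f s IH si dv.
have fi : irr f by apply: si; rewrite mem_head.
rewrite IH ?andbT => [|g gs|]; last 2 first.
- by apply: si; rewrite in_cons gs orbT.
- by apply: dvdr_trans dv; rewrite /rprod big_cons; apply/dvdr_mull/dvdr_refl.
apply/negP => /mem_dvdr_rprod[b bE]; apply: nsq; exists (repr f) => //.
apply: dvdr_trans dv; exists b; rewrite /rprod big_cons -/(rprod s) bE.
by rewrite expr2 mulrCA.
Qed.
End NormalizedPolynomials.

(** * Multiples of a given degree, and squarefree classes as sets of irreducibles *)

Section Counting.
Variables (F : finFieldType) (k : nat).
Local Notation poly := {mpoly F[k]}.
Local Notation class := (normpoly F k).
Implicit Types (a b p q : poly) (c : F) (f g h : class) (s : seq class).
Local Notation NN m := (fset_set (@normalized F k m)).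

(** The class of 0 also gets degree 0, which is why [in_normalized] asks separately for a nonzero
    representative. *)
Definition deg h := (msize (repr h)).-1.

Lemma in_normalized m h : (h \in NN m) = (repr h != 0) && (deg h == m).
Proof.
rewrite in_fset_set; last exact: finite_normalized.
rewrite /deg -msize_poly_eq0; apply/idP/idP; rewrite in_setE /normalized /=.
  by move=> ->; rewrite eqxx.
by case: (msize _) => //= n /eqP->.
Qed.

Lemma repr_pi_neq0 p : p != 0 -> repr (\pi_(normpoly F k)%qT p) != 0.
Proof.
move=> p0; have [c c0 ->] := repr_pi p.
by rewrite -mul_mpolyC mulf_neq0 // mpolyC_eq0.
Qed.

Lemma deg_pi p : deg (\pi_(normpoly F k)%qT p) = (msize p).-1.
Proof. by rewrite /deg; have [c c0 ->] := repr_pi p; rewrite msizeZ. Qed.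

Lemma predn_msizeM p q : p != 0 -> q != 0 ->
  (msize (p * q)).-1 = ((msize p).-1 + (msize q).-1)%N.
Proof.
move=> p0 q0; rewrite msizeM // (mpolySpred _ p0) (mpolySpred _ q0) /=.
by rewrite addnS.
Qed.

Lemma deg_rprod s : {in s, forall f, irr f} ->
  (msize (rprod s)).-1 = (\sum_(f <- s) deg f)%N.
Proof.
elim: s => [|f s IH] si; first by rewrite /rprod !big_nil msize1.
have si' : {in s, forall f, irr f} by move=> g gs; apply: si; rewrite in_cons gs orbT.
rewrite /rprod !big_cons predn_msizeM ?rprod_neq0 -?IH //.
by apply/irr_neq0/si; rewrite mem_head.
Qed.

(** Sending a class [g] to the class of [a * repr g] is a bijection from degree [m - deg a] onto the
    multiples of [a] of degree [m]. The case distinction guards against truncated subtraction. *)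
Lemma count_multiples m a : a != 0 ->
  count (fun f => `[< dvdr a (repr f) >]) (NN m) =
  if ((msize a).-1 <= m)%N then numN F k (m - (msize a).-1) else 0%N.
Proof.
move=> a0; set d := (msize a).-1.
case: ltnP => [lt|le]; last first.
  rewrite -size_filter -[RHS](size_map (fun g => \pi_(normpoly F k)%qT (a * repr g))).
  apply: perm_size; apply: uniq_perm; first by rewrite filter_uniq ?fset_uniq.
    rewrite map_inj_in_uniq ?fset_uniq // => g g'; rewrite !in_normalized.
    move=> _ _ /pi_eqP[c c0]; rewrite scalerAr => /(mulfI a0) E.
    by rewrite -[g]reprK -[g']reprK; apply/pi_eqP; exists c.
  move=> f; rewrite mem_filter in_normalized; apply/idP/mapP.
    move=> /and3P[/asboolP[b fE] f0 /eqP fm].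
    have b0 : b != 0 by apply: contra_neq f0 => b0; rewrite fE b0 mul0r.
    exists (\pi b)%qT.
      rewrite in_normalized repr_pi_neq0 // deg_pi /= -fm /deg fE predn_msizeM //.
      by rewrite addnK.
    have [c c0 ->] := repr_pi b; rewrite -[f in LHS]reprK; apply/pi_eqP; exists c^-1.
      by rewrite invr_eq0.
    by rewrite -scalerAr scalerA mulVf // scale1r fE mulrC.
  move=> [g]; rewrite in_normalized => /andP[g0 /eqP gd] ->.
  rewrite repr_pi_neq0 ?mulf_neq0 // deg_pi predn_msizeM //=.
  have [c c0 ->] := repr_pi (a * repr g); apply/andP; split.
    by apply/asboolP; rewrite mulrC; apply/dvdrZr/dvdr_mull/dvdr_refl.
  by rewrite -/(deg g) gd subnKC.
apply/eqP; rewrite -leqn0 leqNgt -has_count; apply/hasPn => f.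
rewrite in_normalized => /andP[f0 /eqP fm]; apply/asboolP => -[b fE].
have b0 : b != 0 by apply: contra_neq f0 => b0; rewrite fE b0 mul0r.
by move: lt; rewrite -fm /deg fE predn_msizeM // -/d ltnNge leq_addl.
Qed.

(** A finite ground set: its subsets stand for products of distinct irreducibles, so sums over them
    are ordinary finite sums. The bound [D] lets one ground set serve every degree up to [D]. *)
Definition irrs D : {fset class} :=
  fset_set [set h : class | irr h /\ (deg h <= D)%N]%classic.

Lemma in_irrs D h : (h \in irrs D) = `[< irr h >] && (deg h <= D)%N.
Proof.
rewrite in_fset_set.
  by apply/idP/andP; rewrite in_setE /= => -[hi hD]; split=> //; apply/asboolP.
apply: (@sub_finite_set _ _ (\bigcup_(i in `I_D.+1) @normalized F k i)%classic).
  move=> f [fi fD]; exists (deg f) => //=.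
  by rewrite /normalized /= /deg -mpolySpred // irr_neq0.
by apply: bigcup_finite => // i _; apply: finite_normalized.
Qed.

Variable D : nat.
Implicit Type P : {set irrs D}.

Definition elems P : seq class := [seq val x | x <- enum P].

Lemma elems_uniq P : uniq (elems P).
Proof. by rewrite map_inj_uniq ?enum_uniq //; apply: val_inj. Qed.

Lemma irr_val (f : irrs D) : irr (val f).
Proof. by have := valP f; rewrite in_irrs => /andP[/asboolP]. Qed.

Lemma elems_irr P : {in elems P, forall f, irr f}.
Proof. by move=> _ /mapP[f _ ->]; apply: irr_val. Qed.

Lemma mem_elems P (f : irrs D) : (val f \in elems P) = (f \in P).
Proof. by rewrite mem_map ?mem_enum //; apply: val_inj. Qed.

Definition setprod P : class := (\pi_(normpoly F k) (rprod (elems P)))%qT.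
Definition setdeg P : nat := (\sum_(x in P) deg (val x))%N.

Lemma deg_elems P : (msize (rprod (elems P))).-1 = setdeg P.
Proof. by rewrite (deg_rprod (@elems_irr P)) big_map big_enum. Qed.

Lemma in_normalized_setprod P d : (setprod P \in NN d) = (setdeg P == d).
Proof.
rewrite in_normalized repr_pi_neq0 ?rprod_neq0 ?deg_pi ?deg_elems //.
exact: elems_irr.
Qed.

Lemma mobius_setprod P : mobius (setprod P) = (-1) ^+ #|P|.
Proof.
rewrite mobius_rprod ?elems_uniq ?size_map -?cardE //; exact: elems_irr.
Qed.

Lemma setprod_inj : injective setprod.
Proof.
move=> P Q /(rprod_eq_pi (elems_uniq P) (elems_uniq Q) (@elems_irr P) (@elems_irr Q)) E.
by apply/setP => f; rewrite -!mem_elems E.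
Qed.

Lemma setprod_onto h : repr h != 0 -> (deg h <= D)%N -> mobius h != 0 ->
  exists P, setprod P = h.
Proof.
move=> h0 hD /(mobius_factors h0)[s [us si hE]].
pose P : {set irrs D} := [set x | val x \in s]; exists P.
rewrite hE; apply/pi_eqP; exists 1; rewrite ?oner_eq0 // scale1r.
apply: perm_big; apply: uniq_perm; rewrite ?elems_uniq // => f.
apply/mapP/idP => [[g]|fs]; first by rewrite mem_enum inE => gs ->.
(* Degrees add up in the product, so each factor has degree at most [deg h]. *)
have fD : f \in irrs D.
  rewrite in_irrs; apply/andP; split; first exact/asboolP/si.
  apply: leq_trans hD; rewrite hE deg_pi (deg_rprod si) (big_rem f) //=.
  exact: leq_addr.
by exists [` fD]%fset; rewrite // mem_enum inE.
Qed.

(** Each [mobius h] is a sum over the sets [P] with product [h]: there is at most one by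
    injectivity, one if [mobius h] is nonzero, and none otherwise, as its sign would be nonzero.
    Then the two sums are exchanged. *)
Lemma sumA_setprod d : (d <= D)%N ->
  sumA F k d = \sum_(P | setdeg P == d) (-1) ^+ #|P|.
Proof.
move=> dD; rewrite /sumA fsbig_finite; last exact: finite_normalized.
have mobE h : h \in NN d -> mobius h = \sum_(P | setprod P == h) (-1) ^+ #|P|.
  rewrite in_normalized => /andP[h0 /eqP hd].
  have [mh|mh] := eqVneq (mobius h) 0.
    rewrite mh big1 // => P /eqP PE; move: mh; rewrite -PE mobius_setprod => /eqP.
    by rewrite signr_eq0.
  have [|P PE] := setprod_onto h0 _ mh; first by rewrite hd.
  rewrite (big_pred1 P) => [|Q]; first by rewrite -PE mobius_setprod.
  by rewrite -PE inj_eq //; apply: setprod_inj.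
rewrite [LHS]big_seq (eq_bigr _ mobE) -big_seq.
rewrite (exchange_big_dep xpredT) //= [RHS]big_mkcond /=; apply: eq_bigr => P _.
rewrite -in_normalized_setprod; case: ifPn => [Pd|/negP Pd].
  rewrite -big_filter (eq_filter (a2 := pred1 (setprod P))) => [|h]; last by rewrite /= eq_sym.
  by rewrite filter_pred1_uniq ?fset_uniq // big_seq1.
by rewrite big_seq_cond big1 // => h /andP[hd /eqP E]; case: Pd; rewrite E.
Qed.

End Counting.

(** * Counting *)

(** Expanding the product of the factors [G x + 1] gives the alternating sum; a factor with [x] in
    [S] is zero, the others are 1. *)
Lemma sum_subset_sign (T : finType) (S : {set T}) :
  \sum_(P : {set T} | P \subset S) (-1) ^+ #|P| = (S == set0)%:R :> int.
Proof.
pose G x : int := if x \in S then -1 else 0.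
transitivity (\prod_x (G x + 1)); last first.
  have [S0|[x xS]] := set_0Vmem S.
    by rewrite S0 eqxx big1 // => x _; rewrite /G S0 in_set0 add0r.
  rewrite (bigD1 x) //= /G xS addNr mul0r.
  by case: eqP xS => // ->; rewrite in_set0.
rewrite bigA_distr /= big_mkcond /=; apply: eq_bigr => P _.
rewrite -big_mkcond /=; case: ifPn => [/subsetP PS|/subsetPn[x xP xS]].
  by rewrite (eq_bigr (fun=> -1)) ?prodr_const // => x /PS xS; rewrite /G xS.
by rewrite (bigD1 x) //= /G (negPf xS) mul0r.
Qed.

(** * Subsets sorted by their number of members of each index *)

Section SetsByCounts.
Variables (T : finType) (d : nat) (idx : T -> 'I_d).
Implicit Types (P : {set T}) (a : {ffun 'I_d -> 'I_d.+1}).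
Let B i : {set T} := [set x | idx x == i].

(** A set amounts to the family of its traces on the blocks [B i], and these traces are chosen
    independently; the union of a family recovers the set. *)
Lemma card_sets_by_counts a :
  #|[set P | [forall i, #|P :&: B i| == a i]]| = (\prod_i 'C(#|B i|, a i))%N.
Proof.
pose Phi P := [ffun i => P :&: B i].
have PhiI : injective Phi.
  move=> P Q E; apply/setP => x.
  by have /ffunP/(_ (idx x)) := E; rewrite !ffunE => /setP/(_ x); rewrite !inE eqxx !andbT.
rewrite -(card_imset _ PhiI).
pose Fam i := [set A : {set T} | A \subset B i & #|A| == a i].
transitivity #|family Fam|.
  apply: eq_card => f; apply/imsetP/familyP => [[P]|fF].
    by rewrite inE => /forallP aP -> i; rewrite ffunE inE subsetIr aP.
  have fE : f = Phi (\bigcup_i f i).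
    apply/ffunP => i; rewrite ffunE; apply/setP => x; rewrite inE.
    have fB j : f j \subset B j by have := fF j; rewrite inE => /andP[].
    apply/idP/andP => [xf|[/bigcupP[j _ xf]]].
      by split; [apply/bigcupP; exists i|apply: (subsetP (fB i))].
    by have := subsetP (fB j) _ xf; rewrite !inE => /eqP xj /eqP xi; rewrite -xi xj.
  exists (\bigcup_i f i) => //; rewrite inE; apply/forallP => i.
  by have := fF i; rewrite {1}fE ffunE inE => /andP[].
rewrite card_family foldrE big_map big_enum; apply: eq_bigr => i _.
exact: cards_draws.
Qed.

Lemma sum_by_idx P (w : T -> nat) :
  (\sum_(x in P) w x = \sum_i \sum_(x in P :&: B i) w x)%N.
Proof.
rewrite (partition_big idx xpredT) //=; apply: eq_bigr => i _.
by apply: eq_bigl => x; rewrite !inE.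
Qed.

Lemma weight_by_counts P :
  (\sum_(x in P) (idx x).+1 = \sum_(i < d) i.+1 * #|P :&: B i|)%N.
Proof.
rewrite sum_by_idx; apply: eq_bigr => i _.
transitivity (\sum_(x in P :&: B i) i.+1)%N; last by rewrite sum_nat_const mulnC.
by apply: eq_bigr => x; rewrite !inE => /andP[_ /eqP->].
Qed.

Lemma card_by_counts P : (#|P| = \sum_(i < d) #|P :&: B i|)%N.
Proof.
by rewrite -sum1_card sum_by_idx; apply: eq_bigr => i _; rewrite sum1_card.
Qed.

(** The sets are grouped by their vector of counts: the sign is constant on each group, and
    [card_sets_by_counts] gives its size. *)
Lemma sum_sign_by_counts :
  \sum_(P : {set T} | (\sum_(x in P) (idx x).+1 == d)%N) (-1) ^+ #|P| =
  \sum_(a : {ffun 'I_d -> 'I_d.+1} | (\sum_(i < d) i.+1 * a i == d)%N)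
    (-1) ^+ (\sum_(i < d) a i)%N * \prod_(i < d) ('C(#|B i|, a i))%:Z :> int.
Proof.
(* [inord] does not alter the counts that matter: total weight [d] with weights at least 1 forces
   every count to be at most [d]. *)
pose cnt P : {ffun 'I_d -> 'I_d.+1} := [ffun i => inord #|P :&: B i|].
have cntE P : (\sum_(x in P) (idx x).+1 = d)%N -> forall i, cnt P i = #|P :&: B i| :> nat.
  move=> Pd i; rewrite ffunE inordK // ltnS -[leqRHS]Pd weight_by_counts.
  by rewrite (bigD1 i) //= mulSn -addnA leq_addr.
rewrite (partition_big cnt (fun a => \sum_(i < d) i.+1 * a i == d)%N) /=; last first.
  move=> P /eqP Pd; rewrite -[in X in _ == X]Pd weight_by_counts; apply/eqP.
  by apply: eq_bigr => i _; rewrite cntE.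
apply: eq_bigr => a /eqP ad.
rewrite (eq_bigl [in [set P | [forall i, #|P :&: B i| == a i]]]) => [|P]; last first.
  rewrite inE; apply/andP/forallP => [[/eqP Pd /eqP <-] i|aP]; first by rewrite cntE.
  have Pd : (\sum_(x in P) (idx x).+1 = d)%N.
    by rewrite weight_by_counts -[RHS]ad; apply: eq_bigr => i _; rewrite (eqP (aP i)).
  split; first exact/eqP.
  by apply/eqP/ffunP => i; apply: val_inj; rewrite /= cntE // (eqP (aP i)).
rewrite (eq_bigr (fun=> (-1) ^+ (\sum_(i < d) a i)%N)) => [|P]; last first.
  rewrite inE => /forallP aP; rewrite card_by_counts; congr (_ ^+ _).
  by apply: eq_bigr => i _; rewrite (eqP (aP i)).
rewrite sumr_const card_sets_by_counts -mulr_natr natr_prod.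
by congr (_ * _); apply: eq_bigr => i _; rewrite natz.
Qed.
End SetsByCounts.

(** * The binomial formula and the count of coprime pairs *)

Section CoprimePairs.
Variables (F : finFieldType) (k : nat).
Local Notation class := (normpoly F k).
Implicit Types (f g : class).
Local Notation NN m := (fset_set (@normalized F k m)).

Lemma irr_deg_gt0 f : irr f -> (0 < deg f)%N.
Proof.
case=> f0 fU _; rewrite lt0n; apply: contra fU => /eqP fd.
have /msize1_polyC fE : (msize (repr f) <= 1)%N by rewrite (mpolySpred _ f0) -/(deg f) fd.
apply/mpoly_unitP; exists (repr f)@_0 => //.
by rewrite -(mpolyC_eq0 k) -fE.
Qed.

Lemma card_irrs_deg d (i : 'I_d) :
  #|[set x : irrs F k d | (deg (val x)).-1 == i]| = numI F k i.+1.
Proof.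
rewrite cardE -(size_map val) /numI; apply: perm_size; apply: uniq_perm.
- by rewrite map_inj_uniq ?enum_uniq //; apply: val_inj.
- exact: fset_uniq.
move=> f; rewrite in_fset_set; last first.
  apply: sub_finite_set (@finite_normalized F k i.+1) => g [].
  by [].
apply/mapP/idP => [[x]|].
  rewrite mem_enum inE => /eqP xi ->; have xI := irr_val x; rewrite in_setE; split=> //.
  by rewrite /normalized /= -xi prednK ?irr_deg_gt0 // /deg -mpolySpred // irr_neq0.
rewrite in_setE => -[]; rewrite /normalized /= => fd fI.
have degf : deg f = i.+1 by rewrite /deg fd.
have fX : f \in irrs F k d by rewrite in_irrs degf ltn_ord andbT; apply/asboolP.
by exists [` fX]%fset; rewrite // mem_enum inE /= degf.
Qed.

Lemma sumA_binomial d :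
  sumA F k d =
    \sum_(a : {ffun 'I_d -> 'I_d.+1} | (\sum_(i < d) i.+1 * a i == d)%N)
      (-1) ^+ (\sum_(i < d) a i)%N *
      \prod_(i < d) ('C(numI F k i.+1, a i))%:Z.
Proof.
have degP (x : irrs F k d) : (0 < deg (val x) <= d)%N.
  have xI := irr_val x; have := valP x; rewrite in_irrs => /andP[_ ->].
  by rewrite irr_deg_gt0.
have idxP (x : irrs F k d) : ((deg (val x)).-1 < d)%N.
  by case/andP: (degP x) => x0; rewrite prednK.
(* Index [i] stands for degree [i + 1]: irreducibles have positive degree, here at most [d]. *)
pose idx x := Ordinal (idxP x).
rewrite (@sumA_setprod _ _ d) //.
under eq_bigl => P do rewrite /setdeg.
rewrite (eq_bigl (fun P : {set irrs F k d} => (\sum_(x in P) (idx x).+1)%N == d)) => [|P].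
  rewrite sum_sign_by_counts; apply: eq_bigr => a _; congr (_ * _).
  by apply: eq_bigr => i _; rewrite -card_irrs_deg.
congr (_ == _); apply: eq_bigr => x _ /=; rewrite prednK //.
by case/andP: (degP x).
Qed.

(** The sets [P] in the sum are exactly the subsets of the set [S] of common irreducible divisors,
    so the sum tells whether [S] is empty. The bound [minn m n] misses no common irreducible
    divisor. *)
Lemma coprime_sum_setprod m n f g : f \in NN m -> g \in NN n ->
  (`[< is_gcd 1 (repr f) (repr g) >])%:R =
  \sum_(P : {set irrs F k (minn m n)} |
          `[< dvdr (rprod (elems P)) (repr f) >] && `[< dvdr (rprod (elems P)) (repr g) >])
    (-1) ^+ #|P| :> int.
Proof.
rewrite !in_normalized => /andP[f0 /eqP fm] /andP[g0 /eqP gn].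
pose S : {set irrs F k (minn m n)} :=
  [set x : irrs F k (minn m n) | `[< dvdr (repr (val x)) (repr f) >] && `[< dvdr (repr (val x)) (repr g) >]].
rewrite (eq_bigl (fun P : {set irrs F k (minn m n)} => P \subset S)) => [|P]; last first.
  have dP := rprod_dvdrP _ (elems_uniq P) (@elems_irr _ _ _ P).
  apply/andP/subsetP => [[/asboolP/dP Pf /asboolP/dP Pg] x xP|PS].
    by rewrite inE; apply/andP; split; apply/asboolP; [apply: Pf|apply: Pg]; rewrite mem_elems.
  by split; apply/asboolP/dP => _ /mapP[x + ->]; rewrite mem_enum => /PS;
    rewrite inE => /andP[/asboolP ? /asboolP ?].
rewrite sum_subset_sign; congr (_%:R); apply: congr1.
apply/asboolP/eqP => [[_ _ gcdP]|S0].
  apply/setP => x; rewrite !inE; apply/negP => /andP[/asboolP xf /asboolP xg].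
  have [_ xU _] := irr_val x.
  by have := dvdr_unit (unitr1 _) (gcdP _ xf xg); apply/negP.
split; [exact/unit_dvdr/unitr1|exact/unit_dvdr/unitr1|move=> e ef eg].
have e0 := dvdr_neq0 f0 ef.
(* If the common divisor [e] had a prime factor [p], the class of [p] would lie in the empty set
   [S]; so [e] is a unit. *)
have [u [[|p s] [uU sP eE]]] := @mpoly_ufd F k e e0.
  by apply: unit_dvdr; rewrite eE big_nil mulr1.
have pI : irreducible p by apply/prime_eltW/sP; rewrite mem_head.
have pe : dvdr p e by rewrite eE big_cons; apply/dvdr_mull/dvdr_mulr/dvdr_refl.
have [c c0 pE] := repr_pi p; set h := (\pi p)%qT in pE.
have hf : dvdr (repr h) (repr f) by rewrite pE; apply/dvdrZl/(dvdr_trans pe).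
have hg : dvdr (repr h) (repr g) by rewrite pE; apply/dvdrZl/(dvdr_trans pe).
have degh f' m' : repr f' != 0 -> deg f' = m' -> dvdr (repr h) (repr f') -> (deg h <= m')%N.
  move=> f'0 <- [b bE]; move: f'0; rewrite /deg bE mulf_eq0 negb_or => /andP[b0 h0].
  by rewrite predn_msizeM // leq_addl.
have hX : h \in irrs F k (minn m n).
  rewrite in_irrs leq_min (degh f) ?(degh g) //= andbT.
  by apply/asboolP/irr_pi.
by have := in_set0 [` hX]%fset; rewrite -S0 inE /= !asboolT.
Qed.

Lemma numP_count m n :
  (numP F k m n)%:Z =
  \sum_(f <- NN m) \sum_(g <- NN n) (`[< is_gcd 1 (repr f) (repr g) >])%:R.
Proof.
pose cop (fg : class * class) := `[< is_gcd 1 (repr fg.1) (repr fg.2) >].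
have -> : numP F k m n = count cop [seq (f, g) | f <- NN m, g <- NN n].
  rewrite -size_filter /numP; apply: perm_size; apply: uniq_perm.
  - exact: fset_uniq.
  - by rewrite filter_uniq // allpairs_uniq ?fset_uniq // => -[? ?] [].
  have finN i := @finite_normalized F k i.
  move=> [f g]; rewrite mem_filter in_fset_set; last first.
    apply: sub_finite_set (finite_setX (finN m) (finN n)) => -[f' g'] [] /=.
    by [].
  apply/idP/andP => [|[/asboolP /= fg]].
    rewrite in_setE => -[/= fm gn fg]; split; first exact/asboolP.
    by apply/allpairsP; exists (f, g); split=> //=; rewrite in_fset_set ?in_setE.
  case/allpairsP=> -[f' g'] /= [+ + [? ?]]; subst f' g'.
  by rewrite !in_fset_set // !in_setE.
rewrite -natz -sum1_count natr_sum big_mkcond big_allpairs /=.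
by apply: eq_bigr => f _; apply: eq_bigr => g _; rewrite /cop /=; case: ifP.
Qed.

(** Both sides equal the sum over [P] of its sign times the numbers of multiples of its product in
    degrees [m] and [n]: the left side by exchanging summations, the right side by sorting the sets
    by degree. *)
Lemma numP_sum_setprod m n :
  (numP F k m n)%:Z =
  \sum_(0 <= d < (minn m n).+1)
    (numN F k (m - d))%:Z * (numN F k (n - d))%:Z * sumA F k d.
Proof.
rewrite numP_count; set D := minn m n.
pose dvd (P : {set irrs F k D}) f : bool := `[< dvdr (rprod (elems P)) (repr f) >].
pose e (P : {set irrs F k D}) : int := (-1) ^+ #|P|.
transitivity (\sum_(P : {set irrs F k D})
    (\sum_(f <- NN m) (dvd P f)%:R) * (\sum_(g <- NN n) (dvd P g)%:R) * e P).
  under [RHS]eq_bigr => P _ do rewrite big_distrlr /= mulr_suml.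
  rewrite [RHS]exchange_big /= !big_seq; apply: eq_bigr => f fm.
  under [RHS]eq_bigr => P _ do rewrite mulr_suml.
  rewrite [RHS]exchange_big /= !big_seq; apply: eq_bigr => g gn.
  rewrite (coprime_sum_setprod fm gn) big_mkcond /=; apply: eq_bigr => P _.
  by rewrite -/(dvd P f) -/(dvd P g); case: (dvd P f); case: (dvd P g);
    rewrite ?mul0r ?mulr0 ?mul0r ?mul1r.
have dvdN P i : \sum_(f <- NN i) (dvd P f)%:R =
    (if (setdeg P <= i)%N then numN F k (i - setdeg P) else 0%N)%:Z.
  rewrite -deg_elems -count_multiples ?rprod_neq0 //; last exact: elems_irr.
  rewrite -natz -sum1_count natr_sum [RHS]big_mkcond /=; apply: eq_bigr => f _.
  by rewrite /dvd; case: asbool.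
transitivity (\sum_(0 <= d < D.+1) \sum_(P : {set irrs F k D} | setdeg P == d)
    (numN F k (m - d))%:Z * (numN F k (n - d))%:Z * e P); last first.
  rewrite !big_nat; apply: eq_bigr => d; rewrite ltnS => dD.
  by rewrite (sumA_setprod _ _ dD) mulr_sumr.
rewrite (exchange_big_dep xpredT) //=; apply: eq_bigr => P _.
rewrite !dvdN; have [PD|DP] := leqP (setdeg P) D.
  move: (PD); rewrite leq_min => /andP[-> ->].
  rewrite -big_filter (_ : filter _ _ = [:: setdeg P]) ?big_seq1 //.
  rewrite (eq_filter (a2 := pred1 (setdeg P))) => [|d]; last by rewrite /= eq_sym.
  by rewrite filter_pred1_uniq ?iota_uniq // mem_index_iota.
(* A set of degree above [D] matches no [d] on the right, and on the left its product has no
   multiple of degree [m] or none of degree [n]. *)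
rewrite [RHS]big_nat_cond [RHS]big1 => [|d /andP[/andP[_ dD] /eqP Pd]]; last first.
  by move: dD; rewrite -Pd ltnS leqNgt DP.
by move: DP; rewrite gtn_min !ltnNge => /orP[] /negPf ->; rewrite ?mulr0 ?mul0r.
Qed.

End CoprimePairs.

(* [a i] is the exponent a_(i+1); the constraint forces each of them to be at
   most [d], so the codomain ['I_d.+1] loses nothing. *)
Theorem mainTheorem9 (F : finFieldType) (k m n : nat) (hk : (1 <= k)%N) :
  (numP F k m n)%:Z =
    \sum_(0 <= d < (minn m n).+1)
      (numN F k (m - d))%:Z * (numN F k (n - d))%:Z * sumA F k d
  /\
  forall d : nat,
    sumA F k d =
      \sum_(a : {ffun 'I_d -> 'I_d.+1} | (\sum_(i < d) i.+1 * a i == d)%N)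
        (-1) ^+ (\sum_(i < d) a i)%N *
        \prod_(i < d) ('C(numI F k i.+1, a i))%:Z.
Proof. by split; [apply: numP_sum_setprod|apply: sumA_binomial]. Qed.
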